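(* Let $0<a<1/3$ and let $E\subset[0,1]$ be the middle-$a$ fat Cantor set. Then $E$ contains an infinite geometric progression with every quotient $q\in(0,1)$; that is, for every $q\in(0,1)$ there exists $c\ne0$ such that $cq^n\in E$ for all integers $n\ge0$.
   Context: Given a sequence $t_0,t_1,\ldots$ of positive reals with $\sum_{k=0}^\infty 2^kt_k\le1$, define sets $E_0\supset E_1\supset\cdots$ inductively, each $E_k$ being the union of $2^k$ disjoint closed intervals of equal length: $E_0=[0,1]$, and $E_{k+1}$ is obtained from $E_k$ by removing an open interval of length $t_k$ from the middle of (i.e. centered in) each of the $2^k$ closed intervals of $E_k$. The set $E=\bigcap_{k=0}^\infty E_k$ is called the symmetric Cantor set with parameters $(t_k)$. For $0<a<1/3$, the middle-$a$ fat Cantor set is the symmetric Cantor set with parameters $t_k=a^{k+1}$, $k\ge0$. *)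

(* Defs.v *)
From HB Require Import structures.
From mathcomp Require Import all_boot all_order all_algebra.
From mathcomp Require Import all_classical all_reals all_analysis.
From mathcomp Require Import ring lra.
Set Implicit Arguments.
Unset Strict Implicit.
Unset Printing Implicit Defensive.
Import Order.TTheory GRing.Theory Num.Theory.
Import numFieldNormedType.Exports.
Local Open Scope classical_set_scope.
Local Open Scope ring_scope.

(* A closed interval [l, r] is encoded by the pair (l, r); removing the open
   interval of length s centered in [l, r] leaves two closed intervals. *)
Definition remove_middle (R : realType) (s : R) (J : R * R) : seq (R * R) :=
  let m := (J.1 + J.2) / 2 in [:: (J.1, m - s / 2); (m + s / 2, J.2)].

Fixpoint cantor_intervals (R : realType) (t : nat -> R) (k : nat) :
    seq (R * R) :=
  if k is j.+1 then
    flatten [seq remove_middle (t j) J | J <- cantor_intervals t j]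
  else [:: (0, 1)].

Definition cantor_stage (R : realType) (t : nat -> R) (k : nat) : set R :=
  \bigcup_(J in [set` cantor_intervals t k]) `[J.1, J.2]%classic.

(* This condition makes each gap fit strictly inside its interval; the
   sets below are defined for all t, but are only meaningful under it. *)
Definition cantor_parameters (R : realType) (t : nat -> R) : Prop :=
  (forall k, 0 < t k) /\
  (\sum_(0 <= k <oo) (2 ^+ k * t k)%:E <= 1)%E.

Definition symmetric_cantor (R : realType) (t : nat -> R) : set R :=
  \bigcap_k cantor_stage t k.

Definition fat_parameters (R : realType) (a : R) : nat -> R :=
  fun k => a ^+ k.+1.

Definition fat_cantor (R : realType) (a : R) : set R :=
  symmetric_cantor (fat_parameters a).

Lemma fat_parametersP (R : realType) (a : R) :
  0 < a -> a < 1 / 3 -> cantor_parameters (fat_parameters a).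
Proof.
move=> a0 a3; split=> [k|]; first exact: exprn_gt0.
have t0 k : 0 <= 2 ^+ k * fat_parameters a k.
  by rewrite mulr_ge0 ?exprn_ge0 // ltW.
apply: lime_le.
  by apply: is_cvg_nneseries => k _ _; rewrite lee_fin.
apply: nearW => n; rewrite sumEFin lee_fin.
have : (1 - 2 * a) * (\sum_(0 <= k < n) 2 ^+ k * fat_parameters a k)
       = a * (1 - (2 * a) ^+ n).
  elim: n => [|n IH]; first by rewrite big_nil expr0; ring.
  rewrite big_nat_recr //= mulrDr IH /fat_parameters !exprMn !exprS; ring.
have : 0 <= (2 * a) ^+ n by rewrite exprn_ge0 //; lra.
nra.
Qed.

(* Main.v *)
Require Import Defs.
From HB Require Import structures.
From mathcomp Require Import all_boot all_order all_algebra.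
From mathcomp Require Import all_classical all_reals all_analysis.
From mathcomp Require Import ring lra.
Set Implicit Arguments.
Unset Strict Implicit.
Unset Printing Implicit Defensive.
Import Order.TTheory GRing.Theory Num.Theory.
Import numFieldNormedType.Exports.
Local Open Scope classical_set_scope.
Local Open Scope ring_scope.

(** The point 0 is a density point of the Cantor set E, with a power rate: the
    complement of E has relative measure O(x^e) in ]0, x], for some e > 0.
    For r > 0 small, the parameters c in ]0, r] such that c q^n misses E form
    the q^-n-dilate of the part of the complement lying in ]0, r q^n], so their
    measure is O(r (r q^n)^e).  Summed over n this is O(r^(1 + e)), a geometric
    series of ratio q^e, and it is smaller than r once r is small.  Hence some
    c in ]0, r] avoids all these sets, which means that c q^n lies in E for
    every n.  No restriction on q is involved.

    The density estimate comes from counting gaps.  If E has measure at least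
    mu > 0, the 2^k intervals of stage k have length at least mu / 2^k, so gap
    number j of that stage (counted from 0, from left to right) starts beyond
    (j + 1/2) mu / 2^k.  Hence at most y := 2^(k+1) x / mu gaps of stage k meet
    ]0, x[, and none does when y < 1.  When 2^k t_k <= C z^k with z < 1, their
    total length is therefore at most y t_k <= (2 x / mu) C z^k, and since it
    vanishes unless y >= 1, this bound may be multiplied by y^e.  That factor
    brings in the decay x^e at the price of replacing z by 2^e z, which is
    still smaller than 1 if e is small.  Lemmas [mem_scaled_gaps] and
    [measure_scaled_gaps] carry this, and [measure_bigcup_geometric], used once
    for the sum over k and once for the sum over n, assembles the estimate.

    For the middle-a fat Cantor set, z = 2a, C = a and
    mu = 1 - a / (1 - 2a) = (1 - 3a) / (1 - 2a), positive because a < 1/3. *)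

(** * Geometric series and real powers *)

Lemma sum_geometric_le (R : realType) (z : R) (n : nat) : 0 <= z -> z < 1 ->
  \sum_(0 <= k < n) z ^+ k <= (1 - z)^-1.
Proof.
move=> z0 z1.
have z1' : 0 < 1 - z by lra.
have : (1 - z) * \sum_(0 <= k < n) z ^+ k = 1 - z ^+ n.
  elim: n => [|n IH]; first by rewrite big_nil expr0; ring.
  by rewrite big_nat_recr //= mulrDr IH exprS; ring.
have zn0 : 0 <= z ^+ n by rewrite exprn_ge0.
by rewrite -(ler_pM2l z1') mulfV ?gt_eqF // => ->; lra.
Qed.

Lemma measure_bigcup_geometric (R : realType) d (T : measurableType d)
    (m : {measure set T -> \bar R}) (F : nat -> set T) (C z : R) :
  (forall n, measurable (F n)) -> 0 <= C -> 0 <= z -> z < 1 ->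
  (forall n, (m (F n) <= (C * z ^+ n)%:E)%E) ->
  (m (\bigcup_n F n) <= (C / (1 - z))%:E)%E.
Proof.
move=> mF C0 z0 z1 mFle.
apply: (@le_trans _ _ (\sum_(0 <= n <oo) m (F n))%E).
  by apply: measure_sigma_subadditive => //; exact: bigcup_measurable.
apply: lime_le; first by apply: is_cvg_nneseries => n _ _; exact: measure_ge0.
apply: nearW => n.
apply: (@le_trans _ _ (\sum_(0 <= k < n) (C * z ^+ k)%:E)%E).
  by apply: lee_sum => k _.
by rewrite sumEFin lee_fin -mulr_sumr ler_wpM2l // sum_geometric_le.
Qed.

Lemma one_powR (R : realType) (e : R) : 1 `^ e = 1.
Proof. by rewrite powR1. Qed.

Lemma expr_powR (R : realType) (x e : R) (n : nat) : 0 <= x ->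
  (x ^+ n) `^ e = (x `^ e) ^+ n.
Proof. by move=> x0; rewrite -powR_mulrn // powRAC powR_mulrn ?powR_ge0. Qed.

(** Supplies the exponent e of the power rate; the one below gives
    z b^e = sqrt z. *)
Lemma exists_powR_lt1 (R : realType) (b z : R) : 1 < b -> 0 < z -> z < 1 ->
  exists2 e : R, 0 < e & z * b `^ e < 1.
Proof.
move=> b1 z0 z1.
have lnb : 0 < ln b by rewrite ln_gt0.
have lnz : ln z < 0 by rewrite ln_lt0 ?z0.
exists (- ln z / 2 / ln b); first by rewrite !divr_gt0 // oppr_gt0.
rewrite -{1}(lnK z0) /powR gt_eqF; last lra.
rewrite divfK ?gt_eqF // -expRD expR_lt1; lra.
Qed.

(** Selects the scale: the proportion of bad parameters in ]0, r] will be
    bounded by w^e K, where w is proportional to r. *)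
Lemma exists_powR_le (R : realType) (e K : R) : 0 < e -> 0 <= K ->
  exists w : R, [/\ 0 < w, w <= 1 & w `^ e * K < 1].
Proof.
move=> e0 K0.
have K1 : 0 < 1 + K by lra.
exists ((1 + K)^-1 `^ e^-1); split.
- by rewrite powR_gt0 // invr_gt0.
- rewrite -[leRHS](one_powR e^-1) ge0_ler_powR ?nnegrE ?invr_ge0 //; try lra.
  by rewrite invf_le1 //; lra.
- rewrite -powRrM mulVf ?gt_eqF // powRr1 ?invr_ge0; last lra.
  by rewrite mulrC ltr_pdivrMr //; lra.
Qed.

(** * Position of the gaps of a symmetric Cantor set *)

(** The common length of the 2^k intervals of stage k: by then, 2^i gaps of
    length t_i have been removed for each i < k. *)
Definition interval_length (R : realType) (t : nat -> R) (k : nat) : R :=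
  (1 - \sum_(0 <= i < k) 2 ^+ i * t i) / 2 ^+ k.

(** Interval number j of stage k.+1 lies in interval number j./2 of stage k, on
    its right side exactly when j is odd. *)
Fixpoint left_endpoint (R : realType) (t : nat -> R) (k j : nat) : R :=
  if k is i.+1 then
    left_endpoint t i j./2 + (odd j)%:R * (interval_length t k + t i)
  else 0.

Definition gap_start (R : realType) (t : nat -> R) (k j : nat) : R :=
  left_endpoint t k j + interval_length t k.+1.

Lemma interval_lengthS (R : realType) (t : nat -> R) (k : nat) :
  interval_length t k = 2 * interval_length t k.+1 + t k.
Proof.
rewrite /interval_length big_nat_recr //= exprS.
have : (2 : R) ^+ k != 0 by rewrite expf_neq0.
by move=> p0; field.
Qed.

(** The bound on the left endpoint is what makes the counting of gaps possible:
    before interval number j there are j others of the same length. *)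
Lemma cantor_intervals_index (R : realType) (t : nat -> R) (k : nat) (J : R * R) :
  (forall i, 0 <= t i) -> (forall i, 0 <= interval_length t i) ->
  J \in cantor_intervals t k ->
  exists2 j, J = (left_endpoint t k j, left_endpoint t k j + interval_length t k)
    & j%:R * interval_length t k <= left_endpoint t k j.
Proof.
move=> t0 l0; elim: k J => [|k IH] J.
  rewrite /= inE => /eqP ->; exists 0%N => /=; last by rewrite mul0r.
  by rewrite /interval_length big_nil expr0; congr pair; field.
move=> /= /flatten_mapP[J' /IH[j -> jle]].
have lS := interval_lengthS t k.
have t0k := t0 k; have l0k := l0 k.+1.
have jl : j.*2%:R * interval_length t k.+1 <= left_endpoint t k j.
  rewrite -mul2n natrM (le_trans _ jle) // lS.
  have : (0 : R) <= j%:R by [].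
  nra.
rewrite /remove_middle !inE => /orP[] /eqP -> /=.
- exists j.*2; rewrite /= doubleK odd_double mul0r addr0 //.
  by congr pair; rewrite lS; field.
- exists j.*2.+1; rewrite /= uphalf_double odd_double mul1r.
    by congr pair; rewrite lS; field.
  by rewrite -natr1 mulrDl mul1r; lra.
Qed.

(** The inequality on j is kept because an arbitrary index would say nothing
    about the position of the gap. *)
Lemma cantor_stage_or_gap (R : realType) (t : nat -> R) (k : nat) (x : R) :
  (forall i, 0 <= t i) -> (forall i, 0 <= interval_length t i) ->
  cantor_stage t k x -> ~ cantor_stage t k.+1 x ->
  exists2 j, x \in `]gap_start t k j, gap_start t k j + t k[
    & j%:R * interval_length t k <= left_endpoint t k j.
Proof.
move=> t0 l0 [J JE xJ] xN.
have [j Jj jle] := cantor_intervals_index t0 l0 JE.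
exists j => //.
have lS := interval_lengthS t k.
have child I : I \in remove_middle (t k) J -> ~ x \in `[I.1, I.2].
  by move=> IJ xI; apply: xN; exists I => //=; apply/flatten_mapP; exists J.
have := child _ (mem_head _ _).
have : (J.1 + J.2) / 2 + t k / 2 <= x -> False.
  move=> h; apply: (child ((J.1 + J.2) / 2 + t k / 2, J.2)).
    by rewrite !inE eqxx orbT.
  by rewrite in_itv /= h; move: xJ => /=; rewrite in_itv /= => /andP[].
move=> h1 h2.
move: xJ; rewrite /= in_itv /= => /andP[xJ1 xJ2].
rewrite in_itv /= /gap_start; apply/andP; split.
- rewrite ltNge; apply/negP => h; apply: h2; rewrite in_itv /= xJ1 /=.
  by rewrite Jj /=; lra.
- rewrite ltNge; apply/negP => h; apply: h1.
  by rewrite Jj /=; lra.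
Qed.

(** * Measure of the bad parameters at one stage *)

Section ScaledGaps.
Variables (R : realType) (t : nat -> R) (mu : R).
Hypothesis t_ge0 : forall k, 0 <= t k.
Hypothesis mu_gt0 : 0 < mu.
Hypothesis mu_le : forall k, \sum_(0 <= i < k) 2 ^+ i * t i <= 1 - mu.

Lemma interval_length_ge k : mu / 2 ^+ k <= interval_length t k.
Proof.
rewrite /interval_length ler_pM2r ?invr_gt0 ?exprn_gt0 //.
by have := mu_le k; lra.
Qed.

Lemma interval_length_ge0 k : 0 <= interval_length t k.
Proof.
by apply: le_trans (interval_length_ge k); rewrite divr_ge0 ?exprn_ge0 ?ltW.
Qed.

(** An upper bound for the number of stage-k gaps meeting ]0, x[.  Truncated to
    an integer, it is 0 for x < mu / 2^(k+1), where ]0, x[ meets no gap of that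
    stage. *)
Definition gap_bound (k : nat) (x : R) : R := 2 * 2 ^+ k * x / mu.

(** The preimage of gap number j of stage k under c |-> c * s, for s > 0. *)
Definition scaled_gap (s : R) (k j : nat) : set R :=
  [set` `]gap_start t k j / s, (gap_start t k j + t k) / s[].

Definition scaled_gaps (r s : R) (k : nat) : set R :=
  \big[setU/set0]_(j < Num.truncn (gap_bound k (r * s))) scaled_gap s k j.

Lemma measure_scaled_gap (s : R) k j : 0 < s ->
  (lebesgue_measure (scaled_gap s k j) <= (t k / s)%:E)%E.
Proof.
move=> s0; rewrite /scaled_gap lebesgue_measure_itv /=.
case: ifPn => _; first by rewrite -EFinB lee_fin; lra.
by rewrite lee_fin divr_ge0 // ltW.
Qed.

Lemma measurable_scaled_gaps r s k : measurable (scaled_gaps r s k).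
Proof. by apply: bigsetU_measurable => j _; exact: measurable_itv. Qed.

(** If c * s <= r * s falls in gap number j, this gap starts before r * s; as it
    starts after (j + 1/2) mu / 2^k, its index satisfies
    j + 1 <= 2 j + 1 <= gap_bound k (r * s). *)
Lemma mem_scaled_gaps (r s c : R) k :
  0 < s -> c <= r -> cantor_stage t k (c * s) -> ~ cantor_stage t k.+1 (c * s) ->
  scaled_gaps r s k c.
Proof.
move=> s0 cr ck ckS.
have [j] := cantor_stage_or_gap t_ge0 interval_length_ge0 ck ckS.
rewrite in_itv /= => /andP[gc cg] jle.
rewrite /scaled_gaps -(bigcup_mkord _ (scaled_gap s k)); exists j => /=; last first.
  by rewrite /scaled_gap /= in_itv /= ltr_pdivrMr // ltr_pdivlMr // gc.
have p0 : (0 : R) < 2 ^+ k by rewrite exprn_gt0.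
rewrite truncn_gt_nat /gap_bound -natr1 ler_pdivlMr //.
have lk := interval_length_ge k; have lS := interval_length_ge k.+1.
have j0 : (0 : R) <= j%:R by [].
have gs : c * s <= r * s by rewrite ler_wpM2r // ltW.
have : (j%:R + 1) * mu / (2 * 2 ^+ k) <= r * s.
  have -> : (j%:R + 1) * mu / (2 * 2 ^+ k)
      = j%:R * (mu / 2 ^+ k) / 2 + mu / 2 ^+ k.+1.
    by rewrite exprS; field; rewrite gt_eqF.
  have jl : j%:R * (mu / 2 ^+ k) <= j%:R * interval_length t k.
    exact: ler_wpM2l.
  have jm : 0 <= j%:R * (mu / 2 ^+ k).
    by rewrite mulr_ge0 // divr_ge0 ?ltW.
  by move: gc; rewrite /gap_start; lra.
by rewrite ler_pdivrMr ?mulr_gt0 // (mulrC (r * s)).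
Qed.

(** With y := gap_bound k (r * s), the measure is at most y t_k / s, which is
    (2 r / mu) 2^k t_k, and it is 0 when y < 1; so the factor y^e can be
    inserted.  It splits into (2 r / mu)^e, (2^e)^k and s^e, which provides
    summability over s = q^n without losing summability over k. *)
Lemma measure_scaled_gaps (r s e C z : R) k :
  0 < r -> 0 < s -> 0 < e -> 0 <= C -> 0 < z -> 2 ^+ k * t k <= C * z ^+ k ->
  (lebesgue_measure (scaled_gaps r s k)
   <= (r * ((2 * r / mu) `^ e * (2 * C / mu)) * (z * 2 `^ e) ^+ k * s `^ e)%:E)%E.
Proof.
move=> r0 s0 e0 C0 z0 tk.
have p0 : (0 : R) < 2 ^+ k by rewrite exprn_gt0.
have y0 : 0 < gap_bound k (r * s) by rewrite divr_gt0 // !mulr_gt0.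
set N := Num.truncn (gap_bound k (r * s)).
apply: (@le_trans _ _ (N%:R * (t k / s))%:E).
  apply: (le_trans (@Boole_inequality _ _ _ lebesgue_measure (scaled_gap s k) N _)).
    by move=> j _; exact: measurable_itv.
  rewrite mulr_natl -[X in _ *+ X]card_ord -sumr_const -sumEFin.
  apply: lee_sum => j _; exact: measure_scaled_gap.
rewrite lee_fin.
have RHS0 : 0 <= r * ((2 * r / mu) `^ e * (2 * C / mu)) * (z * 2 `^ e) ^+ k * s `^ e.
  by rewrite !mulr_ge0 ?exprn_ge0 ?mulr_ge0 ?powR_ge0 ?invr_ge0 // ltW.
have [y1|y1] := leP 1 (gap_bound k (r * s)); last first.
  suff -> : N = 0%N by rewrite mul0r.
  by apply/eqP; rewrite -leqn0 leqNgt truncn_gt0 -ltNge.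
have Ny : N%:R <= gap_bound k (r * s) by rewrite truncn_le ltW.
have ye : 1 <= gap_bound k (r * s) `^ e.
  by rewrite -[leLHS](one_powR e) ge0_ler_powR ?nnegrE // ltW.
have yeE : gap_bound k (r * s) `^ e = (2 * r / mu) `^ e * (2 `^ e) ^+ k * s `^ e.
  have -> : gap_bound k (r * s) = (2 * r / mu) * 2 ^+ k * s.
    by rewrite /gap_bound; field; rewrite gt_eqF.
  have w0 : 0 <= 2 * r / mu by rewrite divr_ge0 ?mulr_ge0 // ltW.
  have wp0 : 0 <= 2 * r / mu * 2 ^+ k by rewrite mulr_ge0 // ltW.
  rewrite (powRM _ wp0 (ltW s0)) (powRM _ w0 (ltW p0)).
  by rewrite expr_powR.
apply: (@le_trans _ _ (gap_bound k (r * s) * (t k / s))).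
  by rewrite ler_wpM2r // divr_ge0 // ltW.
have -> : gap_bound k (r * s) * (t k / s) = (2 * r / mu) * (2 ^+ k * t k).
  by rewrite /gap_bound; field; rewrite !gt_eqF.
have -> : r * ((2 * r / mu) `^ e * (2 * C / mu)) * (z * 2 `^ e) ^+ k * s `^ e =
    (2 * r / mu) * ((C * z ^+ k) * gap_bound k (r * s) `^ e).
  by rewrite yeE exprMn; field; rewrite gt_eqF.
rewrite ler_wpM2l ?divr_ge0 ?mulr_ge0 ?(ltW r0) ?(ltW mu_gt0) //.
by rewrite (le_trans tk) // ler_peMr // mulr_ge0 // exprn_ge0 // ltW.
Qed.

End ScaledGaps.

(** * Geometric progressions in Cantor sets *)

(** The hypotheses say that E has measure at least mu > 0 and that the measure
    2^k t_k removed at stage k decays geometrically. *)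
Theorem symmetric_cantor_geometric_progression (R : realType) (t : nat -> R)
    (mu C z q : R) :
  (forall k, 0 <= t k) -> 0 < mu ->
  (forall k, \sum_(0 <= i < k) 2 ^+ i * t i <= 1 - mu) ->
  0 <= C -> 0 < z -> z < 1 -> (forall k, 2 ^+ k * t k <= C * z ^+ k) ->
  0 < q -> q < 1 ->
  exists2 c : R, 0 < c & forall n, symmetric_cantor t (c * q ^+ n).
Proof.
move=> t0 mu0 mule C0 z0 z1 tle q0 q1.
(* K is the sum over n and k of the bounds on the measures of the bad sets,
   divided by r and by (2 r / mu)^e. *)
have [e e0 ze] := @exists_powR_lt1 R 2 z (ltr1n _ 2) z0 z1.
have qe1 : q `^ e < 1.
  by rewrite -[ltRHS](one_powR e) gt0_ltr_powR ?nnegrE // ltW.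
pose K := 2 * C / mu / (1 - z * 2 `^ e) / (1 - q `^ e).
have K0 : 0 <= K by rewrite !divr_ge0 ?mulr_ge0 ?subr_ge0 // ltW.
have [w [w0 w1 wK]] := exists_powR_le e0 K0.
pose r := mu * w / 2.
have r0 : 0 < r by rewrite divr_gt0 ?mulr_gt0.
have wE : 2 * r / mu = w by rewrite /r; field; rewrite gt_eqF.
have mu1 : mu <= 1 by have := mule 0%N; rewrite big_nil; lra.
have r1 : r <= 1 by rewrite /r; nra.
pose bad := \bigcup_n \bigcup_k scaled_gaps t mu r (q ^+ n) k.
have mbad n : measurable (\bigcup_k scaled_gaps t mu r (q ^+ n) k).
  by apply: bigcup_measurable => k _; exact: measurable_scaled_gaps.
have bad_small : (lebesgue_measure bad < r%:E)%E.
  (* D is the bound for n = k = 0. *)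
  pose D := r * (w `^ e * (2 * C / mu)).
  have D0 : 0 <= D by rewrite !mulr_ge0 ?powR_ge0 ?invr_ge0 // ltW.
  have DK : D / (1 - z * 2 `^ e) / (1 - q `^ e) = r * (w `^ e * K).
    by rewrite /D /K !mulrA.
  apply: (@le_lt_trans _ _ (r * (w `^ e * K))%:E); last first.
    by rewrite lte_fin -[ltRHS]mulr1 ltr_pM2l.
  rewrite -DK; apply: measure_bigcup_geometric => //.
  - by rewrite divr_ge0 // subr_ge0 ltW.
  - exact: powR_ge0.
  move=> n; have qn0 : 0 < q ^+ n by rewrite exprn_gt0.
  (* For fixed n, the series over k is geometric of ratio z 2^e. *)
  rewrite mulrAC; apply: measure_bigcup_geometric => //.
  - by move=> k; exact: measurable_scaled_gaps.
  - by rewrite mulr_ge0 // exprn_ge0 // powR_ge0.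
  - by rewrite mulr_ge0 ?powR_ge0 // ltW.
  move=> k.
  apply: (le_trans (measure_scaled_gaps t0 mu0 r0 qn0 e0 C0 z0 (tle k))).
  by rewrite lee_fin wE -/D expr_powR ?(ltW q0) // [leRHS]mulrAC.
have [c [cr cbad]] : exists c, c \in `]0, r] /\ ~ bad c.
  apply: contrapT => /forallNP h.
  have : (lebesgue_measure [set` `]0%R, r]] <= lebesgue_measure bad)%E.
    apply: le_measure; rewrite ?inE.
    - exact: measurable_itv.
    - by apply: bigcup_measurable => n _; exact: mbad.
    by move=> c cr; apply: contrapT => cb; apply: (h c).
  by rewrite lebesgue_measure_itv /= lte_fin r0 sube0 leNgt bad_small.
move: cr; rewrite in_itv /= => /andP[c0 cr].
exists c => // n k _.
have qn0 : 0 < q ^+ n by rewrite exprn_gt0.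
have qn1 : q ^+ n <= 1 by rewrite exprn_ile1 // ltW.
(* A point of ]0, 1] can leave the stages only by falling into a gap. *)
elim: k => [|k IH].
  exists (0, 1); first by rewrite /= inE.
  by rewrite /= in_itv /= mulr_ge0 ?(ltW c0) ?(ltW qn0) //=; nra.
apply: contrapT => ckS; apply: cbad; exists n => //; exists k => //.
exact: mem_scaled_gaps.
Qed.

Theorem corollary4p6 (R : realType) (a : R) (a_gt0 : 0 < a) (a_lt : a < 1 / 3) :
  forall q : R, 0 < q -> q < 1 ->
    exists c : R, c != 0 /\ forall n : nat, fat_cantor a (c * q ^+ n).
Proof.
move=> q q0 q1.
have a2 : 0 < 1 - 2 * a by lra.
have tE k : 2 ^+ k * fat_parameters a k = a * (2 * a) ^+ k.
  by rewrite /fat_parameters exprS exprMn; ring.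
have [|||||||c c0 cE] := @symmetric_cantor_geometric_progression R
    (fat_parameters a) ((1 - 3 * a) / (1 - 2 * a)) a (2 * a) q _ _ _ _ _ _ _ q0 q1.
- by move=> k; rewrite exprn_ge0 // ltW.
- by rewrite divr_gt0 //; lra.
- move=> k; under eq_bigr do rewrite tE.
  rewrite -mulr_sumr.
  have -> : 1 - (1 - 3 * a) / (1 - 2 * a) = a * (1 - 2 * a)^-1.
    by field; rewrite gt_eqF.
  by rewrite ler_wpM2l ?sum_geometric_le ?ltW //; lra.
- exact: ltW.
- by lra.
- by lra.
- by move=> k; rewrite tE.
by exists c; split; rewrite ?gt_eqF.
Qed.
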